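(* Let $s\in(0,1)$, let $\phi$ be a strictly convex N-function with Simonenko indices $1\le p\le q<\infty$, let $\Omega\subset\mathbb{R}^n$ be a bounded domain with Lipschitz boundary, and let $u_D\in W^{s,\phi}(\mathbb{R}^n,\mathbb{R}^N)$. Let $u$ be the minimizer of $$\mathcal{J}^s_\phi(v)=\int_{\mathbb{R}^n}\int_{\mathbb{R}^n}\phi\left(\frac{|v(x)-v(y)|}{|x-y|^s}\right)\frac{dx\,dy}{|x-y|^n}$$ over all $v\in u_D+W^{s,\phi}_0(\Omega,\mathbb{R}^N)$. Then $$u(x)\in\overline{\mathrm{conv}}\,u(\Omega^c)\qquad\text{for almost all }x\in\Omega.$$ As a consequence, $\|u\|_{L^\infty(\Omega,\mathbb{R}^N)}\le\|u\|_{L^\infty(\Omega^c,\mathbb{R}^N)}$.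
   Context: An N-function is a function $\phi:[0,\infty)\to[0,\infty)$ that is convex, left-continuous, with $\phi(0)=0$, $\lim_{t\to0}\phi(t)/t=0$ and $\lim_{t\to\infty}\phi(t)/t=\infty$. $\phi'$ is its right-derivative. The Simonenko indices are $p=\inf_{t>0}\frac{\phi'(t)t}{\phi(t)}$ and $q=\sup_{t>0}\frac{\phi'(t)t}{\phi(t)}$. Strictly convex means $\phi(\frac{a+b}{2})<\frac{\phi(a)+\phi(b)}{2}$ for all $0\le a<b$. $L^\phi(\mathbb{R}^n,\mathbb{R}^N)$ is the set of $v\in L^1_{\mathrm{loc}}$ with $\int\phi(|v|/\lambda)\,dx<\infty$ for some $\lambda>0$. $W^{s,\phi}(\mathbb{R}^n,\mathbb{R}^N)$ is the set of $v\in L^\phi(\mathbb{R}^n,\mathbb{R}^N)$ with $\mathcal{J}^s_\phi(v/\lambda)<\infty$ for some $\lambda>0$. $W^{s,\phi}_0(\Omega,\mathbb{R}^N)$ is the set of $v\in W^{s,\phi}(\mathbb{R}^n,\mathbb{R}^N)$ with $v=0$ almost everywhere on $\Omega^c=\mathbb{R}^n\setminus\Omega$. The closed convex hull of the complement values is $$\overline{\mathrm{conv}}\,u(\Omega^c)=\bigcap\{K\subset\mathbb{R}^N\text{ convex, closed}: u(x)\in K\text{ for almost all }x\in\Omega^c\}.$$ *)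

(* Defs.v *)
From HB Require Import structures.
From mathcomp Require Import all_boot all_order all_algebra.
From mathcomp Require Import all_classical all_reals all_analysis.

Set Implicit Arguments.
Unset Strict Implicit.
Unset Printing Implicit Defensive.

Import Order.TTheory GRing.Theory Num.Theory.
Import numFieldNormedType.Exports.

Local Open Scope classical_set_scope.
Local Open Scope ring_scope.

Definition rV_display : measure_display.
Proof. exact: default_measure_display. Qed.

(** The Borel sigma-algebra of R^n, presented as the product sigma-algebra: it
    is generated by the coordinate maps. *)
Section measurable_rV.
Context {R : realType} (n : nat).

Let coor : 'I_n -> 'rV[R]_n -> measurableTypeR R := fun i x => x 0 i.

Let rV_set0 : g_sigma_preimage coor set0.
Proof. exact: sigma_algebra0. Qed.

Let rV_setC A : g_sigma_preimage coor A -> g_sigma_preimage coor (~` A).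
Proof. exact: sigma_algebraC. Qed.

Let rV_bigcup (F : _^nat) : (forall i, g_sigma_preimage coor (F i)) ->
  g_sigma_preimage coor (\bigcup_i (F i)).
Proof. exact: sigma_algebra_bigcup. Qed.

HB.instance Definition _ := @isMeasurable.Build rV_display
  'rV[R]_n (g_sigma_preimage coor) rV_set0 rV_setC rV_bigcup.

Lemma measurable_coord (i : 'I_n) :
  measurable_fun [set: 'rV[R]_n] (fun x => x 0 i : measurableTypeR R).
Proof.
move=> _ Y mY; rewrite setTI; apply: sub_sigma_algebra => /=.
rewrite -bigcup_seq/=; exists i => /=; first by rewrite mem_index_enum.
by exists Y => //; rewrite setTI.
Qed.

Lemma measurable_fun_coordP d (T : measurableType d) (f : T -> 'rV[R]_n) :
  measurable_fun [set: T] f <->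
  forall i, measurable_fun [set: T] (fun t => f t 0 i : measurableTypeR R).
Proof.
split=> [mf i|mf].
  exact: (measurableT_comp (measurable_coord i) mf).
move=> _ A mA; rewrite setTI.
suff : g_sigma_preimage coor `<=` [set B | measurable (f @^-1` B)] by apply.
apply: smallest_sub.
  split => /=.
  - by rewrite preimage_set0.
  - by move=> B mB; rewrite setTD preimage_setC; exact: measurableC.
  - by move=> F mF; rewrite preimage_bigcup; exact: bigcupT_measurable.
rewrite -bigcup_seq => B [i _ [C mC <-]] /=; rewrite setTI.
by rewrite -[X in measurable X]setTI; exact: mf.
Qed.

End measurable_rV.

Section rV_cons.
Context {R : realType} (n : nat).

Definition rV_cons (p : measurableTypeR R * 'rV[R]_n) : 'rV[R]_n.+1 :=
  \row_i if unlift ord0 i is Some j then p.2 0 j else p.1.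

Definition rV_uncons (x : 'rV[R]_n.+1) : measurableTypeR R * 'rV[R]_n :=
  (x 0 ord0, \row_j x 0 (lift ord0 j)).

Lemma rV_consK : cancel rV_cons rV_uncons.
Proof.
move=> [a x]; rewrite /rV_uncons mxE unlift_none; congr pair.
by apply/rowP => j; rewrite !mxE liftK.
Qed.

Lemma rV_unconsK : cancel rV_uncons rV_cons.
Proof.
by move=> x; apply/rowP => i; rewrite !mxE /=; case: unliftP => [j|] -> //;
  rewrite mxE.
Qed.

Lemma measurable_rV_cons : measurable_fun [set: _] rV_cons.
Proof.
apply/measurable_fun_coordP => i.
case: (unliftP ord0 i) => [j|] ij.
  rewrite (_ : (fun _ => _) = (fun x : 'rV[R]_n => x 0 j) \o snd).
    exact: (measurableT_comp (measurable_coord j) measurable_snd).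
  by apply/funext => p; rewrite mxE ij liftK.
rewrite (_ : (fun _ => _) = fst); first exact: measurable_fst.
by apply/funext => p; rewrite mxE ij unlift_none.
Qed.

Lemma measurable_rV_uncons : measurable_fun [set: _] rV_uncons.
Proof.
apply/measurable_fun_pairP; split; first exact: measurable_coord.
apply/measurable_fun_coordP => i.
rewrite (_ : (fun _ => _) = fun x : 'rV[R]_n.+1 => x 0 (lift ord0 i)).
  exact: measurable_coord.
by apply/funext => x /=; rewrite mxE.
Qed.

Variable mu : {sigma_finite_measure set 'rV[R]_n -> \bar R}.

Definition rV_cons_measure : set 'rV[R]_n.+1 -> \bar R :=
  pushforward (lebesgue_measure \x mu)%E rV_cons.

Let cons0 : rV_cons_measure set0 = 0%E.
Proof. by rewrite /rV_cons_measure /pushforward preimage_set0 measure0. Qed.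

Let cons_ge0 A : (0 <= rV_cons_measure A)%E.
Proof. by rewrite /rV_cons_measure /pushforward; exact: measure_ge0. Qed.

Let cons_sigma_additive : semi_sigma_additive rV_cons_measure.
Proof.
have mc A : measurable A -> measurable (rV_cons @^-1` A).
  by move=> mA; rewrite -[X in measurable X]setTI; exact: measurable_rV_cons.
move=> F mF tF mUF; rewrite /rV_cons_measure /pushforward preimage_bigcup.
apply: measure_semi_sigma_additive.
- by move=> k; exact: mc.
- apply/trivIsetP => /= i j _ _ ij; rewrite -preimage_setI.
  by move/trivIsetP : tF => /(_ _ _ _ _ ij) ->//; rewrite preimage_set0.
- by rewrite -preimage_bigcup; exact: mc.
Qed.

HB.instance Definition _ := isMeasure.Build _ _ _ rV_cons_measure
  cons0 cons_ge0 cons_sigma_additive.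

Let cons_sigma_finite : sigma_finite setT rV_cons_measure.
Proof.
have /sigma_finiteP[F [TF ndF Foo]] := sigma_finiteT (@lebesgue_measure R).
have /sigma_finiteP[G [TG ndG Goo]] := sigma_finiteT mu.
exists (fun k => rV_uncons @^-1` (F k `*` G k)).
  apply/seteqP; split => // x _.
  have [i _ Fi] : (\bigcup_i F i) (rV_uncons x).1 by rewrite -TF.
  have [j _ Gj] : (\bigcup_i G i) (rV_uncons x).2 by rewrite -TG.
  exists (maxn i j) => //; split.
  - by move: Fi; exact/subsetPset/ndF/leq_maxl.
  - by move: Gj; exact/subsetPset/ndG/leq_maxr.
move=> k; have [mF Fk] := Foo k; have [mG Gk] := Goo k; split.
  rewrite -[X in measurable X]setTI; apply: measurable_rV_uncons => //.
  exact: measurableX.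
rewrite /rV_cons_measure /pushforward -comp_preimage.
have -> : rV_uncons \o rV_cons = id by apply/funext; exact: rV_consK.
by rewrite preimage_id product_measure1E// lte_mul_pinfty// ge0_fin_numE.
Qed.

HB.instance Definition _ := @Measure_isSigmaFinite.Build _ _ _
  rV_cons_measure cons_sigma_finite.

End rV_cons.

(** Lebesgue measure on the Borel sets of R^n, as an iterated product. *)
Fixpoint borel_lebesgue (R : realType) (n : nat) :
    {sigma_finite_measure set 'rV[R]_n -> \bar R} :=
  match n return {sigma_finite_measure set 'rV[R]_n -> \bar R} with
  | 0 => [the {sigma_finite_measure set 'rV[R]_0 -> \bar R} of dirac (0 : 'rV[R]_0)]
  | m.+1 => [the {sigma_finite_measure set 'rV[R]_m.+1 -> \bar R} of
               rV_cons_measure (borel_lebesgue R m)]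
  end.

Lemma borel_lebesgue_box (R : realType) (n : nat)
    (A : 'I_n -> set (measurableTypeR R)) :
  (forall i, measurable (A i)) ->
  borel_lebesgue R n [set x | forall i, A i (x 0 i)] =
  (\prod_(i < n) lebesgue_measure (A i))%E.
Proof.
elim: n A => [|n IH] A mA.
  rewrite big_ord0 /= diracE mem_set//= => -[].
  by case.
rewrite big_ord_recl -IH; last by move=> i; exact: mA.
have mB : measurable [set x : 'rV[R]_n | forall i, A (lift ord0 i) (x 0 i)].
  rewrite (_ : mkset _ = \bigcap_(i in [set: 'I_n])
    ((fun x : 'rV[R]_n => x 0 i : measurableTypeR R) @^-1` A (lift ord0 i))).
    apply: fin_bigcap_measurable => // i _.
    by rewrite -[X in measurable X]setTI; exact: measurable_coord.
  by apply/seteqP; split => x /= Ax i; [move=> _; exact: Ax|exact: (Ax i)].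
rewrite -product_measure1E//= /rV_cons_measure /pushforward; congr (_ _).
apply/seteqP; split => [p /= Ap|p /= [A0 Ap] i].
  split; first by have := Ap ord0; rewrite mxE unlift_none.
  by move=> i; have := Ap (lift ord0 i); rewrite mxE liftK.
by rewrite mxE; case: unliftP => [j|] ->.
Qed.

(** [lebT R n] is ['rV[R]_n] (up to conversion) with the sigma-algebra of Lebesgue
    measurable sets; [leb R n] is the completion of [borel_lebesgue R n]. *)
Definition lebT (R : realType) (n : nat) : measurableType _ :=
  caratheodory_type (borel_lebesgue R n)^*%mu.

Definition leb (R : realType) (n : nat) : set (lebT R n) -> \bar R :=
  @completed_measure_extension _ _ _ (borel_lebesgue R n).

HB.instance Definition _ (R : realType) (n : nat) := Measure.on (@leb R n).

Lemma leb_sigma_finite (R : realType) (n : nat) :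
  sigma_finite setT (@leb R n).
Proof. exact/completed_measure_extension_sigma_finite/sigma_finiteT. Qed.

HB.instance Definition _ (R : realType) (n : nat) :=
  @Measure_isSigmaFinite.Build _ _ _ (@leb R n) (@leb_sigma_finite R n).

Lemma leb_borel (R : realType) (n : nat) (A : set 'rV[R]_n) :
  measurable A -> @leb R n A = borel_lebesgue R n A.
Proof. exact: measurable_mu_extE. Qed.

Arguments leb : clear implicits.

(** [`|x|] is the library's sup norm on row vectors, hence this one. *)
Definition enorm (R : realType) (n : nat) (x : 'rV[R]_n) : R :=
  Num.sqrt (\sum_(i < n) x 0 i ^+ 2).

(** A function phi : [0,oo) -> [0,oo) is a map R -> R whose values on negative
    numbers are irrelevant. *)
Record Nfunction (R : realType) (phi : R -> R) : Prop := {
  Nf_ge0 : forall t, 0 <= t -> 0 <= phi t;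
  Nf_convex : convex_function [set t : R^o | 0 <= t] phi;
  Nf_left_continuous : forall t, 0 < t -> phi x @[x --> t^'-] --> phi t;
  Nf_0 : phi 0 = 0;
  Nf_lim0 : phi t / t @[t --> 0^'+] --> (0 : R);
  Nf_limy : phi t / t @[t --> +oo] --> +oo }.

Definition midpoint_strictly_convex (R : realType) (phi : R -> R) : Prop :=
  forall a b, 0 <= a -> a < b -> phi ((a + b) / 2) < (phi a + phi b) / 2.

Definition right_derive (R : realType) (phi : R -> R) (t : R) : R :=
  lim ((phi (t + h) - phi t) / h @[h --> 0^'+]).

Definition simonenko_lower (R : realType) (phi : R -> R) : \bar R :=
  ereal_inf [set (right_derive phi t * t / phi t)%:E | t in [set t | 0 < t]].

Definition simonenko_upper (R : realType) (phi : R -> R) : \bar R :=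
  ereal_sup [set (right_derive phi t * t / phi t)%:E | t in [set t | 0 < t]].

(** Near each boundary point, Omega is the strict epigraph of a Lipschitz
    function in the coordinates [y *m Q], [Q] orthogonal; the k-th coordinate is
    the vertical one and [col' k] drops it. *)
Definition lipschitz_boundary (R : realType) (n : nat) (Omega : set 'rV[R]_n)
    : Prop :=
  forall x0, (closure Omega `\` interior Omega) x0 ->
  exists (k : 'I_n) (Q : 'M[R]_n) (g : 'rV[R]_n.-1 -> R) (L : R),
    [/\ Q *m Q^T = 1%:M, L.-lipschitz g &
      \forall y \near x0, Omega y <-> g (col' k (y *m Q)) < (y *m Q) 0 k].

Definition domain (R : realType) (n : nat) (Omega : set 'rV[R]_n) : Prop :=
  [/\ Omega !=set0, open Omega & connected Omega].

Section function_spaces.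
Context {R : realType} (n N : nat) (s : R) (phi : R -> R).
Implicit Types (v u : lebT R n -> 'rV[R]_N).
Local Open Scope ereal_scope.

(** On the (null) diagonal x = y the integrand is 0, as [x / 0 = 0]. *)
Definition J v : \bar R :=
  \int[leb R n]_y \int[leb R n]_x
    (phi (enorm (v x - v y) / enorm ((x : 'rV[R]_n) - y) `^ s)
       / enorm ((x : 'rV[R]_n) - y) ^+ n)%:E.

Definition L1loc v : Prop :=
  measurable_fun [set: lebT R n] v /\
  forall K : set 'rV[R]_n, compact K ->
    \int[leb R n]_(x in K) (enorm (v x))%:E < +oo.

Definition Lphi v : Prop :=
  L1loc v /\ exists2 lambda : R, (0 < lambda)%R &
    \int[leb R n]_x (phi (enorm (v x) / lambda))%:E < +oo.

Definition Wsphi v : Prop :=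
  Lphi v /\ exists2 lambda : R, (0 < lambda)%R &
    J (fun x => lambda^-1 *: v x) < +oo.

Definition Wsphi0 (Omega : set 'rV[R]_n) v : Prop :=
  Wsphi v /\ \forall x \ae leb R n, ~ Omega x -> v x = 0%R.

Definition admissible (Omega : set 'rV[R]_n) uD v : Prop :=
  exists2 w, Wsphi0 Omega w & v = (fun x => uD x + w x)%R.

Definition minimizer (Omega : set 'rV[R]_n) uD u : Prop :=
  admissible Omega uD u /\ forall v, admissible Omega uD v -> J u <= J v.

End function_spaces.

(** Closed convex hull of the (essential) values of u on D. *)
Definition conv_closure (R : realType) (n N : nat) (u : lebT R n -> 'rV[R]_N)
    (D : set 'rV[R]_n) : set 'rV[R]_N :=
  \bigcap_(K in [set K : set 'rV[R]_N | [/\ convex_set K, closed K &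
                   \forall x \ae leb R n, D x -> K (u x)]]) K.

(** The norm of L^oo(D, R^N), that is the L^oo norm of the extension by zero. *)
Definition Linfty_norm (R : realType) (n N : nat) (u : lebT R n -> 'rV[R]_N)
    (D : set 'rV[R]_n) : \bar R :=
  'N[leb R n]_+oo[ (fun x => (enorm (u x))%:E) \_ D ]%E.

(* Main.v *)
Require Import Defs.
From mathcomp Require Import all_boot all_order all_algebra.
From mathcomp Require Import all_classical all_reals all_analysis.
From mathcomp Require Import measurable_realfun ess_sup_inf ring lra.

Set Implicit Arguments.
Unset Strict Implicit.
Unset Printing Implicit Defensive.

Import Order.TTheory GRing.Theory Num.Theory.
Import numFieldNormedType.Exports.

Local Open Scope classical_set_scope.
Local Open Scope ring_scope.

(** The projection onto a closed convex set is 1-Lipschitz, so composing the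
    minimizer with it lowers the energy. It is enough to do this for half-spaces
    H = {y : nu.y <= c}, whose projection is an explicit formula.

    Suppose that u lies in H almost everywhere outside Omega, and let v be the
    projection of u onto H. Outside Omega nothing changes, so v has the right
    boundary values. Since phi(|u|/lambda) is integrable over a set of infinite
    measure, u cannot stay away from 0; hence 0 is in H and |v| <= |u|. Together
    with |v(x) - v(y)| <= |u(x) - u(y)| and the doubling property of phi (a
    consequence of q < oo), this makes v admissible (Wsphi_dominated), and
    J v <= J u. By minimality J v = J u, and this number is finite, again by
    doubling. The integrand of v is below that of u, so for almost every y the
    two integrands agree for almost every x (ge0_integral_eq_ae, used once for
    the outer integral and once for the inner one). Take one such y outside Omega
    with u(y) in H, which exists because the complement of Omega has infinite
    measure. As phi is strictly increasing, |v(x) - v(y)| = |u(x) - u(y)| for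
    almost every x, and the projection onto H preserves the distance to a point
    of H only from points of H (hproj_isometry). So u is in H almost everywhere:
    this is minimizer_halfspace.

    The closed convex hull is an intersection of uncountably many such H. A point
    outside it is separated from some admissible closed convex K by a half-space
    (convex_separation), and has a neighbourhood that is a rational box missing
    this half-space (rat_box_basis). There are countably many rational boxes, and
    u avoids almost everywhere each of those that miss an admissible half-space.

    The L^oo bound is the case where K is the closed ball of radius
    ||u||_{L^oo(Omega^c)}. *)

(** * Euclidean geometry of row vectors *)

Section dot.
Context {R : realType} {N : nat}.
Implicit Types (x y z nu : 'rV[R]_N) (c : R).

Definition dot x y : R := \sum_(i < N) x 0 i * y 0 i.

Lemma dotC x y : dot x y = dot y x.
Proof. by apply: eq_bigr => i _; rewrite mulrC. Qed.

Lemma dotDr x y z : dot x (y + z) = dot x y + dot x z.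
Proof. by rewrite -big_split; apply: eq_bigr => i _; rewrite mxE mulrDr. Qed.

Lemma dotZr (a : R) x y : dot x (a *: y) = a * dot x y.
Proof. by rewrite mulr_sumr; apply: eq_bigr => i _; rewrite mxE mulrCA. Qed.

Lemma dotNr x y : dot x (- y) = - dot x y.
Proof. by rewrite -scaleN1r dotZr mulN1r. Qed.

Lemma dotBr x y z : dot x (y - z) = dot x y - dot x z.
Proof. by rewrite dotDr dotNr. Qed.

Lemma dotDl x y z : dot (x + y) z = dot x z + dot y z.
Proof. by rewrite dotC dotDr !(dotC z). Qed.

Lemma dotZl (a : R) x y : dot (a *: x) y = a * dot x y.
Proof. by rewrite dotC dotZr dotC. Qed.

Lemma dotBl x y z : dot (x - y) z = dot x z - dot y z.
Proof. by rewrite dotC dotBr !(dotC z). Qed.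

Lemma dot0r x : dot x 0 = 0.
Proof. by rewrite -(scale0r 0) dotZr mul0r. Qed.

Lemma dot_ge0 x : 0 <= dot x x.
Proof. by apply: sumr_ge0 => i _; rewrite -expr2 sqr_ge0. Qed.

Lemma dot_eq0 x : (dot x x == 0) = (x == 0).
Proof.
apply/eqP/eqP => [|->]; last exact: dot0r.
move=> /psumr_eq0P x0; apply/rowP => i; rewrite mxE.
have /eqP := x0 (fun i _ => sqr_ge0 (x 0 i)) i isT.
by rewrite mulf_eq0 orbb => /eqP.
Qed.

Lemma dot_gt0 x : x != 0 -> 0 < dot x x.
Proof. by rewrite lt_def dot_ge0 dot_eq0 andbT. Qed.

Lemma enorm_ge0 x : 0 <= enorm x.
Proof. exact: sqrtr_ge0. Qed.

Lemma enormE x : enorm x = Num.sqrt (dot x x).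
Proof. by []. Qed.

Lemma sqr_enorm x : enorm x ^+ 2 = dot x x.
Proof. by rewrite enormE sqr_sqrtr// dot_ge0. Qed.

Lemma enorm0 : enorm (0 : 'rV[R]_N) = 0.
Proof. by rewrite enormE dot0r sqrtr0. Qed.

Lemma enormZ (a : R) x : enorm (a *: x) = `|a| * enorm x.
Proof.
rewrite !enormE dotZl dotZr mulrA -expr2 sqrtrM ?sqr_ge0//.
by rewrite sqrtr_sqr.
Qed.

Lemma enormN x : enorm (- x) = enorm x.
Proof. by rewrite -scaleN1r enormZ normrN1 mul1r. Qed.

(** Cauchy-Schwarz, from the expansion of |(x.x) y - (x.y) x|^2 >= 0. *)
Lemma dot_enorm_le x y : dot x y <= enorm x * enorm y.
Proof.
have [->|x0] := eqVneq x 0; first by rewrite dotC dot0r enorm0 mul0r.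
have x1 : 0 < dot x x by exact: dot_gt0.
have e : dot (dot x x *: y - dot x y *: x) (dot x x *: y - dot x y *: x) =
    dot x x * (dot x x * dot y y - dot x y ^+ 2).
  by rewrite !(dotBl, dotBr, dotZl, dotZr) (dotC y x); ring.
have := dot_ge0 (dot x x *: y - dot x y *: x); rewrite e.
rewrite pmulr_rge0// subr_ge0 -!sqr_enorm -exprMn => h.
rewrite (le_trans (ler_norm _))// -ler_sqr ?nnegrE ?mulr_ge0 ?enorm_ge0//.
by rewrite real_normK ?num_real.
Qed.

Lemma ler_enormD x y : enorm (x + y) <= enorm x + enorm y.
Proof.
rewrite -ler_sqr ?nnegrE ?addr_ge0 ?enorm_ge0// sqr_enorm.
rewrite dotDl !dotDr -!sqr_enorm (dotC y x).
have := dot_enorm_le x y; nra.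
Qed.

Lemma ler_enormB x y : enorm (x - y) <= enorm x + enorm y.
Proof. by rewrite (le_trans (ler_enormD _ _))// enormN. Qed.

Lemma ler_coord_enorm x i : `|x 0 i| <= enorm x.
Proof.
rewrite -sqrtr_sqr enormE ler_wsqrtr// /dot (bigD1 i)//= -expr2 lerDl.
by apply: sumr_ge0 => j _; rewrite -expr2 sqr_ge0.
Qed.

(** The Euclidean projection onto the half-space dot nu y <= c, for nu != 0. *)
Definition hproj nu c y := y - (Num.max 0 (dot nu y - c) / dot nu nu) *: nu.

Lemma hproj_id nu c y : dot nu y <= c -> hproj nu c y = y.
Proof.
by move=> yc; rewrite /hproj max_l ?subr_le0// mul0r scale0r subr0.
Qed.

(** The exact loss of squared distance under the projection: with t the
    difference of the positive parts of a and b, monotonicity of the positive part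
    gives t * (a - b) >= t ^+ 2, so the loss is nonnegative. *)
Lemma sqr_enorm_hprojB nu c y z : nu != 0 ->
  let a := dot nu y - c in let b := dot nu z - c in
  let t := Num.max 0 a - Num.max 0 b in
  enorm (y - z) ^+ 2 =
    enorm (hproj nu c y - hproj nu c z) ^+ 2 + (2 * t * (a - b) - t ^+ 2) / dot nu nu.
Proof.
move=> /dot_gt0 nu0 /=; rewrite /hproj.
set a := Num.max 0 (dot nu y - c); set b := Num.max 0 (dot nu z - c).
have -> : y - (a / dot nu nu) *: nu - (z - (b / dot nu nu) *: nu) =
    y - z - ((a - b) / dot nu nu) *: nu.
  by rewrite mulrBl; apply/rowP => i; rewrite !mxE; ring.
have -> : dot nu y - c - (dot nu z - c) = dot nu (y - z) by rewrite dotBr; ring.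
rewrite !sqr_enorm !(dotBl _ (_ *: _)) !(dotBr _ _ (_ *: _)) !dotZl !dotZr.
rewrite (dotC _ nu); field.
by rewrite gt_eqF.
Qed.

Lemma enorm_hprojB_le nu c y z : nu != 0 ->
  enorm (hproj nu c y - hproj nu c z) <= enorm (y - z).
Proof.
move=> nu0; rewrite -ler_sqr ?nnegrE ?enorm_ge0// (sqr_enorm_hprojB c y z nu0).
rewrite lerDl divr_ge0 ?dot_ge0//.
move: (dot nu y - c) (dot nu z - c) => a b.
by have [a0|a0] := leP 0 a; have [b0|b0] := leP 0 b; rewrite ?subr0 ?sub0r;
  have := sqr_ge0 (a - b); have := mulr_ge0 (normr_ge0 a) (normr_ge0 b);
  rewrite ?(ger0_norm a0) ?(ltr0_norm a0) ?(ger0_norm b0) ?(ltr0_norm b0) => *;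
  nra.
Qed.

Lemma enorm_hproj_le nu c y : nu != 0 -> 0 <= c -> enorm (hproj nu c y) <= enorm y.
Proof.
move=> nu0 c0; have := enorm_hprojB_le c y 0 nu0.
by rewrite (hproj_id (y := 0)) ?dot0r// !subr0.
Qed.

(** When z is in the half-space and y is not, b <= 0 < a and t = a, so that the
    loss of squared distance is at least a ^+ 2 / |nu|^2. *)
Lemma hproj_isometry nu c y z : nu != 0 -> dot nu z <= c ->
  enorm (hproj nu c y - hproj nu c z) = enorm (y - z) -> dot nu y <= c.
Proof.
move=> nu0 zc e; have := sqr_enorm_hprojB c y z nu0.
rewrite e => /esym/eqP; rewrite -[X in _ == X]addr0 (inj_eq (addrI _)).
rewrite mulf_eq0 invr_eq0 dot_eq0 (negbTE nu0) orbF.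
rewrite [Num.max 0 (dot nu z - c)]max_l ?subr_le0//.
case: (leP 0 (dot nu y - c)) => [|/ltW]; last by rewrite subr_le0.
rewrite le_eqVlt => /predU1P[/esym/eqP|yc]; first by rewrite subr_eq0 => /eqP ->.
by move=> /eqP; nra.
Qed.

Lemma continuous_dot nu : continuous (dot nu).
Proof.
apply: (continuous_big (op := @GRing.add R)) => [x|i _ x].
  exact: add_continuous.
exact: cvgMl_tmp (@coord_continuous R 1 N 0 i x).
Qed.

Lemma continuous_dotxx : continuous (fun x => dot x x).
Proof.
apply: (continuous_big (op := @GRing.add R)) => [x|i _ x].
  exact: add_continuous.
exact: cvgM (@coord_continuous R 1 N 0 i x) (@coord_continuous R 1 N 0 i x).
Qed.

Lemma continuous_enorm : continuous (@enorm R N).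
Proof.
move=> x; rewrite /continuous_at.
apply: (@continuous_comp _ _ _ (fun x => dot x x) (@Num.sqrt R)).
  exact: continuous_dotxx.
exact: sqrt_continuous.
Qed.

Lemma open_dot_gt nu c : open [set y | c < dot nu y].
Proof.
by move/continuousP : (@continuous_dot nu) => /(_ [set t | c < t]); apply;
  exact: open_gt.
Qed.

Lemma closed_enorm_le c : closed [set y : 'rV[R]_N | enorm y <= c].
Proof.
by move/continuous_closedP : continuous_enorm => /(_ [set t | t <= c]); apply;
  exact: closed_le.
Qed.

Lemma convex_enorm_le c : convex_set [set y : 'rV[R]_N | enorm y <= c].
Proof.
apply/convex_setW => x y /set_mem /= xc /set_mem /= yc k k0 k1.
apply/mem_set => /=.
change (enorm (k%:num *: (x : 'rV[R]_N) + (1 - k%:num) *: (y : 'rV[R]_N)) <= c).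
have k1' : 0 <= 1 - k%:num by rewrite subr_ge0 ltW.
rewrite (le_trans (ler_enormD _ _))// !enormZ !ger0_norm//; nra.
Qed.

Lemma nearest_point (K : set 'rV[R]_N) z : K !=set0 -> closed K ->
  exists2 p, K p & forall k, K k -> dot (z - p) (z - p) <= dot (z - k) (z - k).
Proof.
move=> [k0 Kk0] clK; pose f y := dot (z - y) (z - y).
have cf : continuous f.
  move=> y; apply: (@continuous_comp _ _ _ (fun y => z - y) (fun x => dot x x)).
    exact: (@cvgB _ _ _ (nbhs y) _ (cst z) id z y (@cvg_cst _ z _ _ _) cvg_id).
  exact: continuous_dotxx.
pose A := K `&` [set y | f y <= f k0].
have clA : closed A.
  apply: closedI => //.
  by move/continuous_closedP : cf => /(_ [set t | t <= f k0]); apply;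
    exact: closed_le.
have bA : bounded_set A.
  exists (enorm z + Num.sqrt (f k0)); split; first by rewrite num_real.
  move=> M zM y [_ /= yk0]; apply: (le_trans _ (ltW zM)).
  rewrite /Num.Def.normr/= mx_normrE; apply/bigmax_leP; split => [|[i j] _ /=].
    by rewrite addr_ge0 ?enorm_ge0 ?sqrtr_ge0.
  rewrite (ord1 i) (le_trans (ler_coord_enorm _ _))//.
  rewrite -{1}(subKr z y) (le_trans (ler_enormB _ _))// lerD2l.
  by rewrite enormE ler_wsqrtr.
(* The distance to z is minimized over a sublevel set, which is compact. *)
have [||c] := @EVT_min_rV R N f A _ (bounded_closed_compact bA clA).
- by exists k0; split => /=.
- by apply: continuous_subspaceT.
rewrite inE => -[Kc fck0] cmin; exists c => // k Kk.
have [kk0|kk0] := leP (f k) (f k0); first by apply: cmin; rewrite inE.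
by rewrite (le_trans fck0)// ltW.
Qed.

(** Separation by the hyperplane through the nearest point p of K, orthogonal to
    z - p: if k in K were beyond it, then moving from p towards k would approach
    z. *)
Lemma convex_separation (K : set 'rV[R]_N) z : K !=set0 -> closed K ->
  convex_set K -> ~ K z ->
  exists nu c, [/\ nu != 0, c < dot nu z & forall k, K k -> dot nu k <= c].
Proof.
move=> K0 clK cvK Kz; have [p Kp pmin] := nearest_point z K0 clK.
have zp : z - p != 0.
  by rewrite subr_eq0; apply: contra_notN Kz => /eqP ->.
exists (z - p), (dot (z - p) p); split => //.
  by rewrite -subr_gt0 -dotBr dot_gt0.
move=> k Kk; rewrite -subr_le0 -dotBr leNgt; apply/negP => a0.
set a := dot (z - p) (k - p) in a0.
set b := dot (k - p) (k - p).
have b0 : 0 <= b := dot_ge0 _.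
(* |z - p - t (k - p)|^2 = |z - p|^2 - 2 t a + t^2 b falls below |z - p|^2 for
   t = a / (a + b), which is also at most 1. *)
have t01 : 0 <= a / (a + b) <= 1.
  by rewrite divr_ge0 ?addr_ge0 ?(ltW a0)//= ler_pdivrMr ?ltr_wpDr// mul1r lerDl.
have [t0 t1] := andP t01.
pose t : {i01 R} := Itv01 t0 t1.
have /set_mem/pmin := cvK k p t (mem_set Kk) (mem_set Kp).
have -> : (z : 'rV[R]_N) - conv t (k : convex_lmodType 'rV[R]_N) p =
    (z - p) - (a / (a + b)) *: (k - p).
  change (z - ((a / (a + b)) *: k + (1 - a / (a + b)) *: p) =
    (z - p) - (a / (a + b)) *: (k - p)).
  by apply/rowP => i; rewrite !mxE; ring.
rewrite !(dotBl _ (_ *: _)) !(dotBr _ _ (_ *: _)) !dotZl !dotZr.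
rewrite (dotC (k - p) (z - p)) -/a -/b.
have ab : 0 < a + b by rewrite ltr_wpDr.
have -> : forall A, A - a / (a + b) * a - (a / (a + b) * a -
   a / (a + b) * (a / (a + b) * b)) = A - a ^+ 2 * (2 * a + b) / (a + b) ^+ 2.
  by move=> A; field; rewrite gt_eqF.
have : 0 < a ^+ 2 * (2 * a + b) / (a + b) ^+ 2.
  by rewrite divr_gt0 ?exprn_gt0// mulr_gt0 ?exprn_gt0//; lra.
lra.
Qed.

(** Open cubes with rational centre and radius 1/(k+1): a countable basis of the
    topology, used to make open sets Borel and to reduce uncountably many
    almost-everywhere statements to countably many. *)
Definition rat_box (r : 'rV[rat]_N * nat) : set 'rV[R]_N :=
  [set y | forall i, `|y 0 i - ratr (r.1 0 i)| < r.2.+1%:R^-1].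

Lemma rat_box_basis (U : set 'rV[R]_N) z : open U -> U z ->
  exists2 r, rat_box r z & rat_box r `<=` U.
Proof.
move=> oU Uz; have /nbhs_ballP[e /= e0 eU] := oU z Uz.
have [k ke] : exists k, k.+1%:R^-1 < e / 2.
  have e2 : 0 < e / 2 by rewrite divr_gt0.
  have [k _ /(_ k (leqnn _))] := near_infty_natSinv_lt (PosNum e2).
  by exists k.
have rP i : {q : rat | `|z 0 i - ratr q| < k.+1%:R^-1}.
  apply/cid.
  have [|q] := @rat_in_itvoo R (z 0 i - k.+1%:R^-1) (z 0 i + k.+1%:R^-1).
    by rewrite ltrD2l -subr_gt0 opprK addr_gt0 ?invr_gt0.
  by rewrite in_itv /= => qz; exists q; rewrite ltr_distlC.
exists (\row_i sval (rP i), k) => [i /=|y yr].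
  by rewrite mxE; exact: svalP (rP i).
apply: eU; split => // i j; rewrite (ord1 i) /ball/=.
have := yr j; have := svalP (rP j); rewrite /= mxE.
rewrite (distrC (y 0 j)) => h1 h2.
rewrite (le_lt_trans (ler_distD (ratr (sval (rP j))) _ _))//.
rewrite (splitr e); apply: ltrD.
  by rewrite (lt_trans h1).
by rewrite (lt_trans h2).
Qed.

End dot.

(** * N-functions *)

Section Nfunction.
Context {R : realType} (phi : R -> R).
Hypotheses (hphi : Nfunction phi) (hconv : midpoint_strictly_convex phi).

Lemma Nf_segment x y t : 0 <= x -> 0 <= y -> 0 <= t <= 1 ->
  phi (t * x + (1 - t) * y) <= t * phi x + (1 - t) * phi y.
Proof.
move=> x0 y0 /andP[t0 t1].
by have := Nf_convex hphi (Itv01 t0 t1) (mem_set x0) (mem_set y0).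
Qed.

(** Strict convexity between 0 and t forbids phi t = 0. *)
Lemma Nf_gt0 t : 0 < t -> 0 < phi t.
Proof.
move=> t0; have := hconv (lexx 0) t0; rewrite (Nf_0 hphi) !add0r => h.
have := Nf_ge0 hphi (ltW (divr_gt0 t0 (ltr0Sn R 1))); lra.
Qed.

Lemma Nf_lt a b : 0 <= a -> a < b -> phi a < phi b.
Proof.
move=> a0 ab; have b0 : 0 < b := le_lt_trans a0 ab.
have := @Nf_segment b 0 (a / b) (ltW b0) (lexx 0).
rewrite divr_ge0 ?(ltW b0)//= ler_pdivrMr// mul1r (ltW ab) => /(_ isT).
rewrite divfK ?gt_eqF// (Nf_0 hphi) !mulr0 !addr0 => h.
by rewrite (le_lt_trans h)// gtr_pMl ?Nf_gt0// ltr_pdivrMr// mul1r.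
Qed.

Lemma Nf_le a b : 0 <= a -> a <= b -> phi a <= phi b.
Proof.
by move=> a0; rewrite le_eqVlt => /predU1P[->//|ab]; rewrite ltW// Nf_lt.
Qed.

Lemma Nf_inj a b : 0 <= a -> 0 <= b -> phi a = phi b -> a = b.
Proof.
move=> a0 b0 e; case: (ltgtP a b) => // [ab|ba].
  by have := Nf_lt a0 ab; rewrite e ltxx.
by have := Nf_lt b0 ba; rewrite e ltxx.
Qed.

Lemma Nf_slope_le x y z : 0 <= x -> x < y -> y < z ->
  (phi y - phi x) / (y - x) <= (phi z - phi y) / (z - y).
Proof.
move=> x0 xy yz; have xz := lt_trans xy yz.
have z0 : 0 <= z by rewrite (le_trans x0)// ltW.
have xz0 : 0 < z - x by rewrite subr_gt0.
have t01 : 0 <= (y - x) / (z - x) <= 1.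
  by rewrite divr_ge0 ?subr_ge0 ?(ltW xy) ?(ltW xz)//= ler_pdivrMr// mul1r; lra.
have := Nf_segment z0 x0 t01.
have -> : (y - x) / (z - x) * z + (1 - (y - x) / (z - x)) * x = y.
  by field; rewrite gt_eqF.
rewrite -(ler_pM2r xz0).
have -> : ((y - x) / (z - x) * phi z + (1 - (y - x) / (z - x)) * phi x) *
   (z - x) = (y - x) * phi z + (z - y) * phi x.
  by field; rewrite gt_eqF.
move=> h.
rewrite ler_pdivrMr ?subr_gt0// mulrAC ler_pdivlMr ?subr_gt0//.
lra.
Qed.

Lemma Nf_slope_homo x y z : 0 <= x -> x < y -> y <= z ->
  (phi y - phi x) / (y - x) <= (phi z - phi x) / (z - x).
Proof.
move=> x0 xy; rewrite le_eqVlt => /predU1P[->//|yz].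
have := Nf_slope_le x0 xy yz.
rewrite ler_pdivrMr ?subr_gt0// mulrAC ler_pdivlMr ?subr_gt0// => h.
rewrite ler_pdivrMr ?subr_gt0// mulrAC ler_pdivlMr ?subr_gt0 ?(lt_trans xy)//.
lra.
Qed.

(** The difference quotients at r decrease as h does and are bounded below by the
    chord slope on the left of r; hence the limit that defines the right
    derivative exists and inherits the bound. *)
Lemma right_derive_ge t r : 0 <= t -> t < r ->
  (phi r - phi t) / (r - t) <= right_derive phi r.
Proof.
move=> t0 tr.
have lb h : 0 < h -> (phi r - phi t) / (r - t) <= (phi (r + h) - phi r) / h.
  move=> h0; have := @Nf_slope_le t r (r + h) t0 tr.
  by rewrite ltrDl => /(_ h0); rewrite addrAC subrr add0r.
apply: limr_ge; last first.
  by near=> h; apply: lb; near: h; exact: nbhs_right_gt.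
apply: nondecreasing_at_right_is_cvgr.
  near=> x => h k; rewrite !in_itv/= => /andP[h0 _] /andP[k0 _] hk.
  have := @Nf_slope_homo r (r + h) (r + k) (ltW (le_lt_trans t0 tr)).
  rewrite ltrDl lerD2l => /(_ h0 hk).
  have e (l : R) : r + l - r = l by ring.
  by rewrite !e.
apply: nearW => x; exists ((phi r - phi t) / (r - t)) => y [h /=].
by rewrite in_itv/= => /andP[h0 _] <-; exact: lb.
Unshelve. all: by end_near. Qed.

Section delta2.
Variable q : R.
Hypotheses (hq : simonenko_upper phi = q%:E) (q1 : 1 <= q).

(** Put e = 1/(2q). The chord from (1 - e) t to t has slope at most phi'(t), so
    phi loses at most e t phi'(t) <= e q phi(t) = phi(t)/2 between t and
    (1 - e) t. *)
Lemma Nf_grow_half t : 0 <= t -> phi t <= 2 * phi ((1 - (2 * q)^-1) * t).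
Proof.
rewrite le_eqVlt => /predU1P[<-|t0].
  by rewrite mulr0 (Nf_0 hphi) mulr0.
have q0 : 0 < q by apply: lt_le_trans q1.
have e0 : 0 < (2 * q)^-1 by rewrite invr_gt0 mulr_gt0.
have e1 : (2 * q)^-1 <= 2^-1 by rewrite lef_pV2 ?posrE ?mulr_gt0// ler_peMr.
set e := (2 * q)^-1 in e0 e1 *.
have st : (1 - e) * t < t by rewrite gtr_pMl// gtrBl.
have s0 : 0 <= (1 - e) * t by apply: mulr_ge0; [lra|exact: ltW].
have pt := Nf_gt0 t0.
have : (right_derive phi t * t / phi t <= q).
  by rewrite -lee_fin -hq; apply: ereal_sup_ubound; exists t.
rewrite ler_pdivrMr// => hd.
have := right_derive_ge s0 st.
have -> : t - (1 - e) * t = e * t by ring.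
rewrite ler_pdivrMr ?mulr_gt0// => hr.
have eq2 : e * q = 2^-1 by rewrite /e; field; rewrite gt_eqF.
have : right_derive phi t * (e * t) <= 2^-1 * phi t.
  by rewrite -eq2 -mulrA mulrCA ler_pM2l.
lra.
Qed.

(** The doubling property: iterate the previous bound until (1 - e)^k c <= 1. *)
Lemma Nf_delta2 c : 0 <= c ->
  exists2 C, 0 <= C & forall t, 0 <= t -> phi (c * t) <= C * phi t.
Proof.
move=> c0.
have q0 : 0 < q by apply: lt_le_trans q1.
have e0 : 0 < (2 * q)^-1 by rewrite invr_gt0 mulr_gt0.
have e1 : (2 * q)^-1 <= 2^-1 by rewrite lef_pV2 ?posrE ?mulr_gt0// ler_peMr.
set e := (2 * q)^-1 in e0 e1 *.
have iter k t : 0 <= t -> phi t <= 2 ^+ k * phi ((1 - e) ^+ k * t).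
  elim: k t => [|k IH] t t0; first by rewrite !expr0 !mul1r.
  rewrite (le_trans (IH t t0))// exprSr -mulrA ler_pM2l ?exprn_gt0//.
  rewrite exprS -mulrA; apply: Nf_grow_half.
  by rewrite mulr_ge0// exprn_ge0//; lra.
have [k kc] : exists k, (1 - e) ^+ k * c <= 1.
  have : (1 - e) ^+ n @[n --> \oo] --> (0 : R).
    by apply: cvg_expr; rewrite ger0_norm; lra.
  move=> /cvgr0_norm_le /(_ (c + 1)^-1); rewrite invr_gt0 ltr_wpDl// => /(_ isT).
  case=> k _ /(_ k (leqnn _)) /=; rewrite ger0_norm ?exprn_ge0//; last by lra.
  move=> h; exists k; rewrite (le_trans (ler_wpM2r _ h))//.
  by rewrite mulrC ler_pdivrMr ?ltr_wpDl// mul1r lerDl.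
exists (2 ^+ k); first by rewrite exprn_ge0.
move=> t t0.
rewrite (le_trans (iter k _ (mulr_ge0 c0 t0)))// ler_pM2l ?exprn_gt0//.
apply: Nf_le; first by rewrite !mulr_ge0// exprn_ge0//; lra.
by rewrite mulrA -[leRHS]mul1r ler_wpM2r.
Qed.

End delta2.
End Nfunction.

(** * Measurability *)

Section measurable_rV_open.
Context {R : realType} {n : nat}.

Lemma measurable_rat_box r : measurable (rat_box r : set 'rV[R]_n).
Proof.
rewrite (_ : rat_box r = \bigcap_(i in [set: 'I_n])
    ((fun x : 'rV[R]_n => x 0 i : measurableTypeR R) @^-1`
     ball (ratr (r.1 0 i) : R) r.2.+1%:R^-1)).
  apply: fin_bigcap_measurable => // i _.
  rewrite -[X in measurable X]setTI; apply: measurable_coord => //.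
  exact: measurable_ball.
apply/seteqP; split => x /= xr i; first by move=> _; rewrite /ball/= distrC.
by have := xr i I; rewrite /ball/= distrC.
Qed.

Lemma open_measurable_rV (U : set 'rV[R]_n) : open U -> measurable U.
Proof.
move=> oU; pose F r : set 'rV[R]_n := [set x | rat_box r `<=` U] `&` rat_box r.
rewrite (_ : U = \bigcup_r F r).
  apply: countable_bigcupT_measurable => // r; rewrite /F.
  have [h|h] := pselect (rat_box r `<=` U).
    rewrite (_ : [set _ | _] = setT) ?setTI; first exact: measurable_rat_box.
    by apply/seteqP; split.
  by rewrite (_ : [set _ | _] = set0) ?set0I//; apply/seteqP; split.
apply/seteqP; split => [x Ux|x [r _ [rU /rU]]//].
by have [r rx rU] := rat_box_basis oU Ux; exists r.
Qed.

Lemma lebT_measurable (A : set 'rV[R]_n) :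
  measurable A -> measurable (A : set (lebT R n)).
Proof. by move=> mA; apply: sub_caratheodory; exact: sub_sigma_algebra. Qed.

Lemma compact_lebT_measurable (K : set 'rV[R]_n) :
  compact K -> measurable (K : set (lebT R n)).
Proof.
move=> /(compact_closed (@norm_hausdorff _ _)) clK.
by apply: lebT_measurable; rewrite -(setCK K); apply: measurableC;
  apply: open_measurable_rV; exact: closed_openC.
Qed.

Lemma measurable_lebT_id :
  measurable_fun [set: lebT R n] (fun x : lebT R n => x : 'rV[R]_n).
Proof. by move=> _ A mA; rewrite setTI; exact: lebT_measurable. Qed.

End measurable_rV_open.

Section measurable_rV_fun.
Context {R : realType} {N : nat} d (T : measurableType d).
Implicit Types f g : T -> 'rV[R]_N.

Lemma measurable_fun_rVD f g : measurable_fun [set: T] f ->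
  measurable_fun [set: T] g -> measurable_fun [set: T] (fun x => f x + g x).
Proof.
move=> /measurable_fun_coordP mf /measurable_fun_coordP mg.
apply/measurable_fun_coordP => i; under eq_fun do rewrite mxE.
exact: (measurable_funD (mf i) (mg i)).
Qed.

Lemma measurable_fun_rVZ (a : T -> R) f : measurable_fun [set: T] a ->
  measurable_fun [set: T] f -> measurable_fun [set: T] (fun x => a x *: f x).
Proof.
move=> ma /measurable_fun_coordP mf.
apply/measurable_fun_coordP => i; under eq_fun do rewrite mxE.
exact: (measurable_funM ma (mf i)).
Qed.

Lemma measurable_fun_rVN f : measurable_fun [set: T] f ->
  measurable_fun [set: T] (fun x => - f x).
Proof.
move=> mf; under eq_fun do rewrite -scaleN1r.
by apply: measurable_fun_rVZ => //; exact: measurable_cst.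
Qed.

Lemma measurable_fun_rVB f g : measurable_fun [set: T] f ->
  measurable_fun [set: T] g -> measurable_fun [set: T] (fun x => f x - g x).
Proof.
by move=> mf mg; apply: measurable_fun_rVD => //; exact: measurable_fun_rVN.
Qed.

Lemma measurable_fun_dot f g : measurable_fun [set: T] f ->
  measurable_fun [set: T] g -> measurable_fun [set: T] (fun x => dot (f x) (g x)).
Proof.
move=> /measurable_fun_coordP mf /measurable_fun_coordP mg.
by apply: measurable_sum => i; exact: (measurable_funM (mf i) (mg i)).
Qed.

Lemma measurable_fun_enorm f : measurable_fun [set: T] f ->
  measurable_fun [set: T] (fun x => enorm (f x)).
Proof.
move=> mf; under eq_fun do rewrite enormE.
apply: measurableT_comp; last exact: measurable_fun_dot.
by apply: nondecreasing_measurable => // x y; exact: ler_wsqrtr.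
Qed.

Lemma measurable_fun_hproj nu c f : measurable_fun [set: T] f ->
  measurable_fun [set: T] (fun x => hproj nu c (f x)).
Proof.
move=> mf; apply: measurable_fun_rVB => //.
apply: measurable_fun_rVZ; last exact: measurable_cst.
apply: measurable_funM; last exact: measurable_cst.
apply: measurable_maxr; first exact: measurable_cst.
apply: measurable_funB; last exact: measurable_cst.
by apply: measurable_fun_dot => //; exact: measurable_cst.
Qed.

End measurable_rV_fun.

Section measurable_phi.
Context {R : realType} (phi : R -> R).
Hypotheses (hphi : Nfunction phi) (hconv : midpoint_strictly_convex phi).

Lemma measurable_fun_Nf d (T : measurableType d) (h : T -> R) :
  (forall x, 0 <= h x) -> measurable_fun [set: T] h ->
  measurable_fun [set: T] (fun x => phi (h x)).
Proof.
move=> h0 mh.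
(* phi is only known to be monotone on the nonnegative reals. *)
rewrite (_ : (fun _ => _) = (fun t => phi (Num.max 0 t)) \o h); last first.
  by apply/funext => x /=; rewrite max_r.
apply: measurableT_comp => //.
apply: nondecreasing_measurable => // s t st.
by apply: (Nf_le hphi hconv); [rewrite le_max lexx|rewrite ge_max !le_max lexx st orbT].
Qed.

Lemma measurable_fun_inv_ge0 d (T : measurableType d) (h : T -> R) :
  (forall x, 0 <= h x) -> measurable_fun [set: T] h ->
  measurable_fun [set: T] (fun x => (h x)^-1).
Proof.
move=> h0 mh; under eq_fun do rewrite -powR_inv1//.
by apply: (measurableT_comp (measurable_powR _)).
Qed.

(** The integrand of J, as a function on the product space. *)
Definition gagliardo n N (s : R) (v : lebT R n -> 'rV[R]_N) (p : lebT R n * lebT R n) :=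
  phi (enorm (v p.1 - v p.2) / enorm ((p.1 : 'rV[R]_n) - p.2) `^ s) /
  enorm ((p.1 : 'rV[R]_n) - p.2) ^+ n.

Lemma gagliardo_ge0 n N s (v : lebT R n -> 'rV[R]_N) p : 0 <= gagliardo s v p.
Proof.
by rewrite divr_ge0 ?exprn_ge0 ?enorm_ge0//; apply: (Nf_ge0 hphi);
  rewrite divr_ge0 ?powR_ge0 ?enorm_ge0.
Qed.

Lemma measurable_gagliardo n N s (v : lebT R n -> 'rV[R]_N) :
  measurable_fun [set: lebT R n] v ->
  measurable_fun [set: lebT R n * lebT R n] (gagliardo s v).
Proof.
move=> mv.
have mr : measurable_fun [set: lebT R n * lebT R n]
    (fun p => enorm ((p.1 : 'rV[R]_n) - p.2)).
  apply: measurable_fun_enorm; apply: measurable_fun_rVB.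
    exact: (measurableT_comp measurable_lebT_id measurable_fst).
  exact: (measurableT_comp measurable_lebT_id measurable_snd).
apply: measurable_funM; last first.
  apply: measurable_fun_inv_ge0; first by move=> p; rewrite exprn_ge0 ?enorm_ge0.
  exact: measurable_funX.
apply: measurable_fun_Nf.
  by move=> p; rewrite divr_ge0 ?powR_ge0 ?enorm_ge0.
apply: measurable_funM.
  apply: measurable_fun_enorm; apply: measurable_fun_rVB.
    exact: (measurableT_comp mv measurable_fst).
  exact: (measurableT_comp mv measurable_snd).
apply: measurable_fun_inv_ge0; first by move=> p; exact: powR_ge0.
exact: (measurableT_comp (measurable_powR _)).
Qed.

Lemma measurable_gagliardo1 n N s (v : lebT R n -> 'rV[R]_N) y :
  measurable_fun [set: lebT R n] v ->
  measurable_fun [set: lebT R n] (fun x => (gagliardo s v (x, y))%:E).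
Proof.
move=> mv; apply/measurable_EFinP.
by apply: (@measurable_fun_pair1 _ _ _ _ _ _ (gagliardo s v) y); exact: measurable_gagliardo.
Qed.

Lemma measurable_gagliardo_int n N s (v : lebT R n -> 'rV[R]_N) :
  measurable_fun [set: lebT R n] v ->
  measurable_fun [set: lebT R n] (fun y => \int[leb R n]_x (gagliardo s v (x, y))%:E)%E.
Proof.
move=> mv; apply: (@measurable_fun_fubini_tonelli_G _ _ _ _ R (leb R n)
  (fun p => (gagliardo s v p)%:E)).
  by apply/measurable_EFinP; exact: measurable_gagliardo.
by move=> p; rewrite lee_fin gagliardo_ge0.
Qed.

End measurable_phi.

(** * Integrals and Lebesgue measure *)

Section integral_equality.
Context d (T : measurableType d) {R : realType} (mu : {measure set T -> \bar R}).
Local Open Scope ereal_scope.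

(** The integrals may be subtracted because they are finite, and a nonnegative
    function with zero integral vanishes almost everywhere. *)
Lemma ge0_integral_eq_ae (f g : T -> \bar R) :
  measurable_fun [set: T] f -> measurable_fun [set: T] g ->
  (forall x, 0 <= f x) -> (forall x, f x <= g x) ->
  \int[mu]_x g x <= \int[mu]_x f x -> \int[mu]_x g x < +oo ->
  \forall x \ae mu, f x = g x.
Proof.
move=> mf mg f0 fg gf goo.
have g0 x : 0 <= g x := le_trans (f0 x) (fg x).
have foo : \int[mu]_x f x < +oo.
  by rewrite (le_lt_trans _ goo)//; exact: ge0_le_integral.
have efg : \int[mu]_x f x = \int[mu]_x g x.
  by apply/eqP; rewrite eq_le gf andbT; exact: ge0_le_integral.
have intf : mu.-integrable [set: T] f.
  by apply/integrableP; split => //; under eq_integral do rewrite gee0_abs//.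
have intg : mu.-integrable [set: T] g.
  by apply/integrableP; split => //; under eq_integral do rewrite gee0_abs//.
have ff := integrable_ae measurableT intf.
have mgf : measurable_fun [set: T] (g \- f) by exact: emeasurable_funB.
have : \int[mu]_x `|(g \- f) x| = 0.
  rewrite (ae_eq_integral (g \- f))//.
  - rewrite integralB// efg subee// ge0_fin_numE//.
    exact: integral_ge0.
  - exact: measurableT_comp.
  - apply: filterS ff => x /(_ I) fx _ /=.
    by rewrite gee0_abs// sube_ge0// fx.
move=> /(ae_eq_integral_abs mu measurableT mgf).
apply: filterS2 ff => x /(_ I) fx /(_ I) /= h.
by rewrite -[LHS]add0e -h subeK.
Qed.

End integral_equality.

Section lebesgue_complement.
Context {R : realType} (m : nat).
Local Open Scope ereal_scope.
Let n := m.+1.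

Lemma leb_setT : leb R n [set: lebT R n] = +oo.
Proof.
rewrite leb_borel; last exact: measurableT.
have -> : [set: 'rV[R]_n] =
    [set x | forall i : 'I_n, [set: measurableTypeR R] (x 0%R i)].
  by apply/seteqP; split.
rewrite (@borel_lebesgue_box R n (fun=> setT))// /n big_ord_recl.
have e : lebesgue_measure [set: R] = +oo :> \bar R.
  by rewrite -set_itvNyy lebesgue_measure_itv.
rewrite e gt0_mulye//.
elim: (index_enum _) => [|i r IH]; first by rewrite big_nil lte01.
by rewrite big_cons mule_gt0// e.
Qed.

Lemma leb_compl_bounded (Omega : set 'rV[R]_n) : bounded_set Omega ->
  exists B : set (lebT R n),
    [/\ measurable B, B `<=` ~` Omega & leb R n B = +oo].
Proof.
move=> [M [_ MO]].
pose A (i : 'I_n) : set (measurableTypeR R) := `[(- (M + 1))%R, (M + 1)%R]%classic.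
pose C : set 'rV[R]_n := [set x | forall i, A i (x 0%R i)].
have mA i : measurable (A i) by exact: measurable_itv.
have mC : measurable C.
  rewrite (_ : C = \bigcap_(i in [set: 'I_n])
    ((fun x : 'rV[R]_n => x 0%R i : measurableTypeR R) @^-1` A i)).
    apply: fin_bigcap_measurable => // i _.
    by rewrite -[X in measurable X]setTI; exact: measurable_coord.
  by apply/seteqP; split => x /= Ax i; [move=> _; exact: Ax|exact: (Ax i I)].
have lC : leb R n C < +oo.
  rewrite leb_borel// (@borel_lebesgue_box R n A)//.
  have lA i : lebesgue_measure (A i) < +oo.
    by rewrite lebesgue_measure_itv; case: ifP => _; rewrite ?ltry// -EFinB ltry.
  elim: (index_enum _) => [|i r IH]; first by rewrite big_nil ltry.
  by rewrite big_cons lte_mul_pinfty// ge0_fin_numE.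
exists (~` C); split.
- by apply: measurableC; exact: lebT_measurable.
- move=> x; apply: contra_not => Ox i.
  have := MO (M + 1)%R; rewrite ltrDl ltr01 => /(_ isT x Ox) /=.
  rewrite /Num.Def.normr/= mx_normrE => /bigmax_leP[_ /(_ (0%R, i) isT)] /=.
  by rewrite /A /= in_itv /= -ler_norml.
- have mCl := lebT_measurable mC.
  have : leb R n [set: lebT R n] = leb R n C + leb R n (~` C).
    rewrite -(setUv C) measureU//; first exact: measurableC.
    exact: setICr.
  rewrite leb_setT.
  by move: (leb R n C) (leb R n (~` C)) lC => [a||] [b||].
Qed.

End lebesgue_complement.

(** * The space of finite energy *)

Lemma le_integral_scaleD d (T : measurableType d) (R : realType)
    (mu : {measure set T -> \bar R}) (D : set T) (C : R) (f g h : T -> \bar R) :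
  measurable D -> 0 <= C ->
  measurable_fun D f -> measurable_fun D g -> measurable_fun D h ->
  (forall x, 0 <= f x)%E -> (forall x, 0 <= g x)%E -> (forall x, 0 <= h x)%E ->
  (forall x, h x <= C%:E * (f x + g x))%E ->
  (\int[mu]_(x in D) h x <=
   C%:E * (\int[mu]_(x in D) f x + \int[mu]_(x in D) g x))%E.
Proof.
move=> mD C0 mf mg mh f0 g0 h0 hfg.
have mfg : measurable_fun D (fun x => f x + g x)%E by exact: emeasurable_funD.
have fg0 x : (0 <= f x + g x)%E by exact: adde_ge0.
rewrite -ge0_integralD// -ge0_integralZl_EFin//.
apply: ge0_le_integral => //.
exact: (measurable_funeM C%:E).
Qed.

Section Wsphi.
Context {R : realType} (n N : nat) (s : R) (phi : R -> R) (q : R).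
Hypotheses (hphi : Nfunction phi) (hconv : midpoint_strictly_convex phi).
Hypotheses (hq : simonenko_upper phi = q%:E) (q1 : 1 <= q).
Implicit Types u v f g : lebT R n -> 'rV[R]_N.

(** 2 a + b is at most max (4 a) (2 b), and doubling absorbs the factors. *)
Lemma Nf_le_sum_scaled l1 l2 : 0 < l1 -> 0 < l2 ->
  exists2 C, 0 <= C & forall t a b, 0 <= t -> 0 <= a -> 0 <= b ->
    t <= 2 * a + b -> phi t <= C * (phi (a / l1) + phi (b / l2)).
Proof.
move=> l10 l20.
have [C1 C10 h1] := Nf_delta2 hphi hconv hq q1 (ltW (mulr_gt0 (ltr0Sn R 3) l10)).
have [C2 C20 h2] := Nf_delta2 hphi hconv hq q1 (ltW (mulr_gt0 (ltr0Sn R 1) l20)).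
exists (C1 + C2) => [|t a b t0 a0 b0 tab]; first exact: addr_ge0.
have {}h1 := h1 _ (divr_ge0 a0 (ltW l10)).
have {}h2 := h2 _ (divr_ge0 b0 (ltW l20)).
have := Nf_ge0 hphi (divr_ge0 a0 (ltW l10)).
have := Nf_ge0 hphi (divr_ge0 b0 (ltW l20)).
have e1 : 4 * l1 * (a / l1) = 4 * a by field; rewrite gt_eqF.
have e2 : 2 * l2 * (b / l2) = 2 * b by field; rewrite gt_eqF.
rewrite e1 in h1; rewrite e2 in h2.
move: h1 h2; set A := phi (a / l1); set B := phi (b / l2) => h1 h2 B0 A0.
have C1B := mulr_ge0 C10 B0; have C2A := mulr_ge0 C20 A0.
have C1A := mulr_ge0 C10 A0; have C2B := mulr_ge0 C20 B0.
have [ba|ab] := leP b (2 * a).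
  have : phi t <= phi (4 * a) by apply: (Nf_le hphi hconv) => //; lra.
  lra.
have : phi t <= phi (2 * b) by apply: (Nf_le hphi hconv) => //; lra.
lra.
Qed.

Lemma J_gagliardo v : J s phi v =
  (\int[leb R n]_y \int[leb R n]_x (gagliardo phi s v (x, y))%:E)%E.
Proof. by []. Qed.

Lemma gagliardoZ v l p : 0 < l ->
  gagliardo phi s (fun x => l^-1 *: v x) p =
  phi (enorm (v p.1 - v p.2) / enorm ((p.1 : 'rV[R]_n) - p.2) `^ s / l) /
  enorm ((p.1 : 'rV[R]_n) - p.2) ^+ n.
Proof.
move=> l0; rewrite /gagliardo -scalerBr enormZ ger0_norm ?invr_ge0 ?ltW//.
by rewrite [X in phi (X / _)]mulrC mulrAC.
Qed.

(** Doubling gives both the stability of the space under sums and the finiteness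
    of J on it. The bound 2 f + g is what is
    needed for a difference v - f with |v| <= |f + g|. *)
Lemma Wsphi_dominated f g v : Wsphi s phi f -> Wsphi s phi g ->
  measurable_fun [set: lebT R n] v ->
  (forall x, enorm (v x) <= 2 * enorm (f x) + enorm (g x)) ->
  (forall x y, enorm (v x - v y) <=
     2 * enorm (f x - f y) + enorm (g x - g y)) ->
  Wsphi s phi v /\ (J s phi v < +oo)%E.
Proof.
move=> [[[mf f1] [a a0 fa]] [b b0 Jf]] [[[mg g1] [a' a'0 ga]] [b' b'0 Jg]] mv vfg dvfg.
have mphi (h : lebT R n -> 'rV[R]_N) l : 0 < l -> measurable_fun [set: lebT R n] h ->
    measurable_fun [set: lebT R n] (fun x => (phi (@enorm R N (h x) / l))%:E).
  move=> l0 mh; apply/measurable_EFinP.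
  apply: (measurable_fun_Nf hphi hconv).
    by move=> x; rewrite divr_ge0 ?enorm_ge0// ltW.
  apply: measurable_funM; last exact: measurable_cst.
  exact: measurable_fun_enorm.
have phi0 (h : lebT R n -> 'rV[R]_N) l x : 0 < l -> (0 <= (phi (@enorm R N (h x) / l))%:E :> \bar R)%E.
  by move=> l0; rewrite lee_fin (Nf_ge0 hphi)// divr_ge0 ?enorm_ge0// ltW.
have Jv : (J s phi v < +oo)%E.
  have [C C0 HC] := Nf_le_sum_scaled b0 b'0.
  have mZ (h : lebT R n -> 'rV[R]_N) l : measurable_fun [set: lebT R n] h ->
      measurable_fun [set: lebT R n] (fun x => l *: h x : 'rV[R]_N).
    by move=> mh; apply: measurable_fun_rVZ => //; exact: measurable_cst.
  have g0 (h : lebT R n -> 'rV[R]_N) x y : (0 <= (@gagliardo R phi n N s h (x, y))%:E :> \bar R)%E.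
    by rewrite lee_fin (gagliardo_ge0 hphi).
  apply: (@le_lt_trans _ _ (C%:E * (J s phi (fun x => b^-1 *: f x)
      + J s phi (fun x => b'^-1 *: g x)))%E); last first.
    by apply: lte_mul_pinfty (lte_add_pinfty Jf Jg); rewrite ?lee_fin.
  rewrite (J_gagliardo v) (J_gagliardo (fun x => b^-1 *: f x)) (J_gagliardo (fun x => b'^-1 *: g x)).
  apply: le_integral_scaleD.
  - exact: measurableT.
  - exact: C0.
  - by apply: (measurable_gagliardo_int hphi hconv); exact: mZ.
  - by apply: (measurable_gagliardo_int hphi hconv); exact: mZ.
  - by apply: (measurable_gagliardo_int hphi hconv).
  - by move=> y; exact: integral_ge0.
  - by move=> y; exact: integral_ge0.
  - by move=> y; exact: integral_ge0.
  move=> y; apply: le_integral_scaleD.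
  - exact: measurableT.
  - exact: C0.
  - by apply: (measurable_gagliardo1 hphi hconv); exact: mZ.
  - by apply: (measurable_gagliardo1 hphi hconv); exact: mZ.
  - by apply: (measurable_gagliardo1 hphi hconv).
  - by move=> x; exact: g0.
  - by move=> x; exact: g0.
  - by move=> x; exact: g0.
  move=> x; rewrite -EFinD -EFinM lee_fin !gagliardoZ// /gagliardo/=.
  set r := enorm ((x : 'rV[R]_n) - y) `^ s.
  have r0 : 0 <= r^-1 by rewrite invr_ge0 powR_ge0.
  rewrite -mulrDl mulrA ler_wpM2r ?invr_ge0 ?exprn_ge0 ?enorm_ge0//.
  apply: HC; rewrite ?mulr_ge0 ?enorm_ge0//.
  by rewrite mulrA -mulrDl ler_wpM2r.
split; last exact: Jv.
split; last first.
  exists 1; first exact: ltr01.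
  rewrite (_ : (fun x => _) = v); first exact: Jv.
  by apply/funext => x; rewrite invr1 scale1r.
split.
  split=> // K cK; have mK := compact_lebT_measurable cK.
  have me (h : lebT R n -> 'rV[R]_N) : measurable_fun [set: lebT R n] h ->
      measurable_fun (K : set (lebT R n)) (fun x : lebT R n => (enorm (h x))%:E).
    move=> mh; apply: measurable_funTS; apply/measurable_EFinP.
    exact: measurable_fun_enorm.
  apply: (@le_lt_trans _ _ (2%:E * (\int[leb R n]_(x in K) (enorm (f x))%:E
      + \int[leb R n]_(x in K) (enorm (g x))%:E))%E); last first.
    by apply: lte_mul_pinfty (lte_add_pinfty (f1 K cK) (g1 K cK)); rewrite ?lee_fin.
  apply: le_integral_scaleD; [exact: mK|exact: ler0n| | | | | | |].
  - exact: me mf.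
  - exact: me mg.
  - exact: me mv.
  - by move=> x; rewrite lee_fin enorm_ge0.
  - by move=> x; rewrite lee_fin enorm_ge0.
  - by move=> x; rewrite lee_fin enorm_ge0.
  move=> x; rewrite -EFinD -EFinM lee_fin (le_trans (vfg x))//.
  by have := enorm_ge0 (g x); lra.
have [C C0 HC] := Nf_le_sum_scaled a0 a'0.
exists 1 => //.
apply: (@le_lt_trans _ _ (C%:E * (\int[leb R n]_x (phi (enorm (f x) / a))%:E
    + \int[leb R n]_x (phi (enorm (g x) / a'))%:E))%E); last first.
  by apply: lte_mul_pinfty (lte_add_pinfty fa ga); rewrite ?lee_fin.
apply: le_integral_scaleD; [exact: measurableT|exact: C0| | | | | | |].
- exact: mphi a0 mf.
- exact: mphi a'0 mg.
- exact: mphi ltr01 mv.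
- by move=> x; exact: phi0.
- by move=> x; exact: phi0.
- by move=> x; exact: phi0.
move=> x; rewrite -EFinD -EFinM lee_fin divr1.
by apply: HC; rewrite ?enorm_ge0.
Qed.

End Wsphi.

(** * Minimizers and half-spaces *)

(* When x is used as a point of R^n in an almost-everywhere formula, its type is
   elaborated as ['rV_n], which carries the Borel sigma-algebra, whereas the
   almost-everywhere filter of [leb R n] is that of Lebesgue measurable sets. *)
#[local] Hint Extern 0 (Filter (nbhs (almost_everywhere (leb ?R ?n)))) =>
  exact (ae_filter_ringOfSetsType (leb R n)) : typeclass_instances.

Section halfspace.
Context {R : realType} (m N : nat) (s : R) (phi : R -> R) (q : R).
Local Notation n := m.+1.
Hypotheses (hphi : Nfunction phi) (hconv : midpoint_strictly_convex phi).
Hypotheses (hq : simonenko_upper phi = q%:E) (q1 : 1 <= q).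
Variables (Omega : set 'rV[R]_n) (bO : bounded_set Omega).
Implicit Types u v : lebT R n -> 'rV[R]_N.

(** The complement of a bounded set is not negligible. *)
Lemma ae_compl_exists (P : lebT R n -> Prop) :
  (\forall x \ae leb R n, P x) -> exists2 x, ~ Omega x & P x.
Proof.
move=> aeP; have [B [mB BO lB]] := leb_compl_bounded bO.
apply: contrapT => h.
have : (leb R n).-negligible B.
  apply: negligibleS aeP => x Bx Px; apply: h; exists x => //.
  exact: BO.
by move=> /(negligibleP (leb R n) mB) /= B0; have := lB; rewrite B0.
Qed.

(** If c < 0 then |u| >= - c / |nu| on a set of infinite measure, so that
    phi(|u| / l) is not integrable. *)
Lemma Lphi_halfspace_ge0 u nu c : Lphi phi u -> nu != 0 ->
  (\forall x \ae leb R n, ~ Omega x -> dot nu (u x) <= c) -> 0 <= c.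
Proof.
move=> [[mu_ _] [l l0 ul]] nu0 uc; rewrite leNgt; apply/negP => c0.
have [B [mB BO lB]] := leb_compl_bounded bO.
have enu : 0 < enorm nu by rewrite enormE sqrtr_gt0 dot_gt0.
pose e := - c / enorm nu.
have e0 : 0 < e by rewrite divr_gt0 ?oppr_gt0.
have mphi : measurable_fun [set: lebT R n] (fun x => (phi (enorm (u x) / l))%:E).
  apply/measurable_EFinP; apply: (measurable_fun_Nf hphi hconv).
    by move=> x; rewrite divr_ge0 ?enorm_ge0// ltW.
  apply: measurable_funM; last exact: measurable_cst.
  exact: measurable_fun_enorm.
have phi0 x : (0 <= (phi (enorm (u x) / l))%:E)%E.
  by rewrite lee_fin (Nf_ge0 hphi)// divr_ge0 ?enorm_ge0// ltW.
have pe : 0 < phi (e / l) by rewrite (Nf_gt0 hphi hconv)// divr_gt0.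
have : (\int[leb R n]_(x in B) cst (phi (e / l))%:E x <=
        \int[leb R n]_x (phi (enorm (u x) / l))%:E)%E.
  apply: (@le_trans _ _ (\int[leb R n]_(x in B) (phi (enorm (u x) / l))%:E)%E).
    apply: ae_ge0_le_integral.
    - exact: mB.
    - by move=> x _; rewrite lee_fin ltW.
    - exact: measurable_cst.
    - by move=> x _; exact: phi0.
    - exact: measurable_funTS mphi.
    - apply: filterS uc => x uc Bx; rewrite lee_fin; apply: (Nf_le hphi hconv).
        by rewrite divr_ge0 ?(ltW e0) ?(ltW l0).
      rewrite ler_pM2r ?invr_gt0// ler_pdivrMr// mulrC.
      rewrite -(enormN (u x)) (le_trans _ (dot_enorm_le _ _))// dotNr lerN2.
      by apply: uc; exact: BO.
  apply: ge0_subset_integral; [exact: mB|exact: measurableT|exact: mphi| |].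
    by move=> x _; exact: phi0.
  by [].
have -> : (\int[leb R n]_(x in B) cst (phi (e / l))%:E x = +oo)%E.
  transitivity ((phi (e / l))%:E * leb R n B)%E; first exact: integral_cst.
  by rewrite lB gt0_muley ?lte_fin.
by move=> /le_lt_trans/(_ ul); rewrite ltxx.
Qed.

Lemma minimizer_halfspace uD u nu c : Wsphi s phi uD ->
  minimizer s phi Omega uD u -> nu != 0 ->
  (\forall x \ae leb R n, ~ Omega x -> dot nu (u x) <= c) ->
  \forall x \ae leb R n, dot nu (u x) <= c.
Proof.
move=> WD [[w [Ww w0] uE] umin] nu0 uc.
have mD := WD.1.1.1; have mw := Ww.1.1.1.
have mu_ : measurable_fun [set: lebT R n] u.
  by rewrite uE; exact: measurable_fun_rVD.
have u_le x : enorm (u x) <= enorm (uD x) + enorm (w x).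
  by rewrite uE; exact: ler_enormD.
have du_le x y : enorm (u x - u y) <= enorm (uD x - uD y) + enorm (w x - w y).
  by rewrite uE opprD addrACA; exact: ler_enormD.
have [Wu Ju] : Wsphi s phi u /\ (J s phi u < +oo)%E.
  apply: (Wsphi_dominated hphi hconv hq q1 WD Ww mu_) => [x|x y].
    rewrite (le_trans (u_le x))// lerD2r.
    by have := enorm_ge0 (uD x); lra.
  rewrite (le_trans (du_le x y))// lerD2r.
  by have := enorm_ge0 (uD x - uD y); lra.
have c0 : 0 <= c by exact: Lphi_halfspace_ge0 Wu.1 nu0 uc.
pose v x := hproj nu c (u x).
have mv : measurable_fun [set: lebT R n] v by exact: measurable_fun_hproj.
have dv x y : enorm (v x - v y) <= enorm (u x - u y) by exact: enorm_hprojB_le.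
have adm : admissible s phi Omega uD v.
  exists (fun x => v x - uD x); last first.
    by apply/funext => x; rewrite addrC subrK.
  split.
    apply: (Wsphi_dominated hphi hconv hq q1 WD Ww _ _ _).1 => [|x|x y].
    - exact: measurable_fun_rVB.
    - rewrite (le_trans (ler_enormB _ _))//.
      by have := enorm_hproj_le (u x) nu0 c0; have := u_le x; rewrite -/(v x); lra.
    - rewrite (_ : _ - _ = (v x - v y) - (uD x - uD y)); last first.
        by apply/rowP => i; rewrite !mxE; ring.
      rewrite (le_trans (ler_enormB _ _))//.
      by have := dv x y; have := du_le x y; lra.
  apply: filterS2 w0 uc => x w0 uc Ox; rewrite /v hproj_id; last exact: uc.
  by rewrite uE addrC addKr w0.
have gle p : gagliardo phi s v p <= gagliardo phi s u p.
  rewrite ler_wpM2r ?invr_ge0 ?exprn_ge0 ?enorm_ge0//.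
  apply: (Nf_le hphi hconv).
    by rewrite divr_ge0 ?enorm_ge0 ?powR_ge0.
  by rewrite ler_wpM2r ?invr_ge0 ?powR_ge0.
have mgu := measurable_gagliardo_int hphi hconv s mu_.
have mgv := measurable_gagliardo_int hphi hconv s mv.
have mgu1 y := measurable_gagliardo1 hphi hconv s y mu_.
have mgv1 y := measurable_gagliardo1 hphi hconv s y mv.
have g0 (f : lebT R n -> 'rV[R]_N) x y :
    (0 <= (gagliardo phi s f (x, y))%:E :> \bar R)%E.
  by rewrite lee_fin (gagliardo_ge0 hphi).
have G0 (f : lebT R n -> 'rV[R]_N) y :
    (0 <= \int[leb R n]_x (gagliardo phi s f (x, y))%:E)%E.
  by apply: integral_ge0 => x _; exact: g0.
have inner_le y : (\int[leb R n]_x (gagliardo phi s v (x, y))%:E <=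
    \int[leb R n]_x (gagliardo phi s u (x, y))%:E)%E.
  apply: ge0_le_integral.
  - exact: measurableT.
  - by move=> x _; exact: g0.
  - exact: mgv1.
  - exact: mgu1.
  - by move=> x _; rewrite lee_fin.
(* Minimality gives J u <= J v, so the two outer integrands agree. *)
have inner_eq := ge0_integral_eq_ae mgv mgu (G0 v) inner_le (umin v adm) Ju.
have inner_fin : \forall y \ae leb R n,
    (\int[leb R n]_x (gagliardo phi s u (x, y))%:E)%E \is a fin_num.
  have : (leb R n).-integrable [set: lebT R n]
      (fun y => \int[leb R n]_x (gagliardo phi s u (x, y))%:E)%E.
    apply/integrableP; split; first exact: mgu.
    under eq_integral do rewrite gee0_abs ?G0//.
    exact: Ju.
  by move=> /(integrable_ae measurableT); apply: filterS => y /(_ I).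
have [y Oy [[yeq yfin] yc]] := ae_compl_exists
  (filterI (filterI inner_eq inner_fin) uc).
have {}yc := yc Oy.
rewrite ge0_fin_numE ?G0// in yfin.
have := @ge0_integral_eq_ae _ _ _ (leb R n) _ _ (mgv1 y) (mgu1 y)
  (fun x => g0 v x y) (fun x => gle (x, y)).
rewrite yeq => /(_ (lexx _) yfin); apply: filterS => x [].
rewrite /gagliardo/=.
(* On the diagonal the integrand is 0 and says nothing, but there u x = u y. *)
have [xy _|xy] := eqVneq (x : 'rV[R]_n) y; first by rewrite xy.
set r := enorm ((x : 'rV[R]_n) - y).
have r0 : 0 < r by rewrite /r enormE sqrtr_gt0 dot_gt0// subr_eq0.
have rs0 : 0 < r `^ s by exact: powR_gt0.
have rn0 : (r ^+ n)^-1 != 0 by rewrite invr_eq0 expf_neq0 ?gt_eqF.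
have rsn0 : (r `^ s)^-1 != 0 by rewrite invr_eq0 gt_eqF.
move=> /(mulIf rn0)/(Nf_inj hphi hconv).
rewrite !divr_ge0 ?enorm_ge0 ?(ltW rs0)// => /(_ isT isT)/(mulIf rsn0).
exact: hproj_isometry.
Qed.

End halfspace.

Theorem lemma4p2 (R : realType) (n N : nat) (hn : (0 < n)%N) (hN : (0 < N)%N)
    (s : R) (hs0 : 0 < s) (hs1 : s < 1)
    (phi : R -> R) (hphi : Nfunction phi)
    (hconv : midpoint_strictly_convex phi)
    (p q : R) (hp : simonenko_lower phi = p%:E)
    (hq : simonenko_upper phi = q%:E) (h1p : 1 <= p) (hpq : p <= q)
    (Omega : set 'rV[R]_n) (hOmega : domain Omega)
    (hbounded : bounded_set Omega) (hlip : lipschitz_boundary Omega)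
    (uD : lebT R n -> 'rV[R]_N) (huD : Wsphi s phi uD)
    (u : lebT R n -> 'rV[R]_N) (hu : minimizer s phi Omega uD u) :
  (\forall x \ae leb R n, Omega x -> conv_closure u (~` Omega) (u x)) /\
  (Linfty_norm u Omega <= Linfty_norm u (~` Omega))%E.
Proof.
case: n hn Omega hOmega hbounded hlip uD huD u hu =>
  // m _ Omega _ bO _ uD WD u umin.
have q1 : 1 <= q := le_trans h1p hpq.
have hull : \forall x \ae leb R m.+1, Omega x -> conv_closure u (~` Omega) (u x).
  (* Boxes that miss some half-space containing u almost everywhere outside
     Omega. *)
  pose good (r : 'rV[rat]_N * nat) := exists nu c, [/\ nu != 0,
    (forall z, rat_box r z -> c < dot nu z) &
    \forall x \ae leb R m.+1, ~ Omega x -> dot nu (u x) <= c].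
  have box r : \forall x \ae leb R m.+1, good r -> ~ rat_box r (u x).
    have [[nu [c [nu0 rc uc]]]|h] := pselect (good r); last by apply: nearW => x /h.
    apply: filterS (minimizer_halfspace hphi hconv hq q1 bO WD umin nu0 uc).
    by move=> x ux _ /rc; rewrite ltNge ux.
  have boxes : \forall x \ae leb R m.+1, forall r, good r -> ~ rat_box r (u x).
    have : \forall x \ae leb R m.+1, forall k, if unpickle k is Some r then
        good r -> ~ rat_box r (u x) else True.
      apply: ae_foralln => k; case: unpickle => [r|]; first exact: box.
      exact: nearW.
    by apply: filterS => x h r; have := h (pickle r); rewrite pickleK.
  apply: filterS boxes => x hx _ K [cvK clK KO]; apply: contrapT => Ku.
  have K0 : K !=set0.
    by have [y Oy Ky] := ae_compl_exists bO KO; exists (u y); exact: Ky.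
  have [nu [c [nu0 cu Kc]]] := convex_separation K0 clK cvK Ku.
  have [r rux rsub] := rat_box_basis (@open_dot_gt _ _ nu c) cu.
  apply: (hx r) => //; exists nu, c; split => //.
  by apply: filterS KO => y Ky /Ky/Kc.
split; first exact: hull.
(* The measure is positive, so the L^oo norm is an essential supremum. *)
pose f D := abse \o ((fun x : lebT R m.+1 => (enorm (u x))%:E) \_ D).
have LE D : Linfty_norm u D = ess_sup (leb R m.+1) (f D).
  have l0 : (0 < leb R m.+1 [set: lebT R m.+1])%E by rewrite leb_setT ltry.
  by rewrite /Linfty_norm unlock ifT.
rewrite !LE; apply/ess_supP.
have fO := ess_sup_ge (leb R m.+1) (f (~` Omega)).
move: (ess_sup _ _) fO => M fM.
have fE (D : set 'rV[R]_m.+1) x : f D x = if x \in D then (enorm (u x))%:E else 0%E.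
  by rewrite /f /= patchE; case: ifP => _; rewrite ?abse0// gee0_abs// lee_fin enorm_ge0.
have M0 : (0 <= M)%E.
  by have [x _ fx] := ae_compl_exists bO fM; exact: le_trans (abse_ge0 _) fx.
case: M fM M0 => [M| |] fM M0 //; last by apply: nearW => x; exact: leey.
pose K := [set y : 'rV[R]_N | enorm y <= M].
have KO : \forall x \ae leb R m.+1, ~ Omega x -> K (u x).
  apply: filterS fM => x; rewrite fE => fx Ox; move: fx.
  by rewrite mem_set// lee_fin.
apply: filterS hull => x hx; rewrite fE; case: ifPn => [|_]; last exact: M0.
rewrite inE lee_fin => Ox; apply: (hx Ox K); split => //.
  exact: convex_enorm_le.
exact: closed_enorm_le.
Qed.
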